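(* Let $X=[0,1]$, let $T$ be the Gauss map and $\mu$ the Gauss measure on $[0,1]$. Let $(k_m)_{m\in\mathbb{N}}$ be a non-decreasing sequence of natural numbers with $k_m\to\infty$, and let $\mathcal{B}=\{B_1\supset B_2\supset\cdots\}$ with $B_m=[0,1/k_m]$. Assume that either there exists $\sigma<1$ such that $k_m\leq \frac{\sigma m}{\log\log m}$ for all but finitely many $m\in\mathbb{N}$, or there exists $\tau>0$ such that $k_m\geq (\log m)^{\tau}$ for all but finitely many $m\in\mathbb{N}$. If $$\sum_{n=1}^\infty \frac{\big(1-\mu(B_{n})\big)^{(\log 2)(1-\epsilon)n}}{n}<\infty$$ for some $\epsilon>0$, then $\mathcal{H}_{\mathrm{e.a.}}(\mathcal{B})$ has full $\mu$-measure. On the other hand, if $$\sum_{n=1}^\infty\frac{\big(1-\mu(B_{n})\big)^{2(\log2)(1+\epsilon)n}}{n}=\infty$$ for some $\epsilon>0$, then $\mathcal{H}_{\mathrm{e.a.}}(\mathcal{B})$ has zero $\mu$-measure.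
   Context: $\mathbb{N}=\{1,2,3,\dots\}$; $\log$ is the natural logarithm. The Gauss map is $T(x)=\frac1x-\lfloor\frac1x\rfloor$ for $x\in(0,1]$ and $T(0)=0$. The Gauss measure is $\mu(B)=\frac{1}{\log2}\int_B\frac{dx}{1+x}$; it is a $T$-invariant probability measure. Thus $\mu(B_m)=\frac{\log(1+1/k_m)}{\log2}$. Up to a null set, $B_m$ is the set of irrational $x\in[0,1]$ whose first continued fraction digit is at least $k_m$. Put $O_m(x)=\{Tx,T^2x,\dots,T^mx\}$. The eventually always hitting set is $$\mathcal{H}_{\mathrm{e.a.}}(\mathcal{B})=\{x\in X: O_m(x)\cap B_m\neq\varnothing\text{ for all but finitely many }m\in\mathbb{N}\}.$$ *)

(* Defs.v *)
From HB Require Import structures.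
From mathcomp Require Import all_boot all_order all_algebra.
From mathcomp Require Import all_classical all_reals all_analysis.
From mathcomp Require Import measurable_realfun.

Set Implicit Arguments.
Unset Strict Implicit.
Unset Printing Implicit Defensive.

Import Order.TTheory GRing.Theory Num.Theory.
Import numFieldNormedType.Exports.

Local Open Scope classical_set_scope.
Local Open Scope ring_scope.

(* As a self-map of the real line; only its values on [0, 1], which it maps
   into itself, are relevant. *)
Definition gauss_map {R : realType} (x : R) : R :=
  if x == 0 then 0 else x^-1 - (Num.floor x^-1)%:~R.

(* The Gauss measure of [0, 1], as a Borel measure on the line carried by
   [0, 1]. *)
Definition gauss_measure {R : realType} (A : set R) : \bar R :=
  ((ln 2)^-1%:E *
     \int[lebesgue_measure]_(x in (A `&` `[0, 1])%R) ((1 + x)^-1)%:E)%E.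

Definition orbit_segment {U : Type} (T : U -> U) (x : U) (m : nat) : set U :=
  [set iter j T x | j in [set j | (1 <= j <= m)%N]].

Definition eventually_always_hitting {U : Type} (X : set U) (T : U -> U)
    (B : nat -> set U) : set U :=
  [set x | X x /\ \forall m \near \oo, orbit_segment T x m `&` B m !=set0].

Section gauss_measure.
Context {R : realType}.
Local Notation leb := (@lebesgue_measure R).
Local Notation gauss := (@gauss_measure R).

Let dens (x : R) : R := (1 + x)^-1.

Let ln2_gt0 : 0 < ln 2 :> R.
Proof. by rewrite ln_gt0// ltr1n. Qed.

Let dens_cont x : 0 <= x -> {for x, continuous dens}.
Proof.
move=> x0; apply: cvgV; first by rewrite gt_eqF// ltr_pwDl.
by apply: cvgD; [exact: cvg_cst|exact: cvg_id].
Qed.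

Let dens_meas (A : set R) : measurable A ->
  measurable_fun (A `&` `[0, 1]) (fun x : R => (dens x)%:E).
Proof.
move=> mA; apply/measurable_EFinP.
have : measurable_fun (`[0, 1] : set R) dens; last first.
  by apply: measurable_funS => //; exact: subIsetr.
apply: subspace_continuous_measurable_fun => //.
apply: continuous_in_subspaceT => x; rewrite inE/= in_itv/= => /andP[x0 _].
exact: dens_cont.
Qed.

Let dens_ge0 (A : set R) x : (A `&` `[0, 1]) x -> (0 <= (dens x)%:E)%E.
Proof.
case=> _ /=; rewrite in_itv/= => /andP[x0 _].
by rewrite lee_fin invr_ge0 addr_ge0.
Qed.

Let gauss0 : gauss set0 = 0%E.
Proof. by rewrite /gauss_measure set0I integral_set0 mule0. Qed.

Let gauss_ge0 A : (0 <= gauss A)%E.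
Proof.
apply: mule_ge0; first by rewrite lee_fin invr_ge0 ltW.
by apply: integral_ge0 => x; exact: dens_ge0.
Qed.

Let gauss_sigma_additive : semi_sigma_additive gauss.
Proof.
move=> F mF tF mUF.
have e n : (\sum_(0 <= i < n) gauss (F i) = (ln 2)^-1%:E *
    \sum_(0 <= i < n) \int[leb]_(x in (F i `&` `[0, 1])%R) (dens x)%:E)%E.
  rewrite ge0_sume_distrr// => i _.
  by apply: integral_ge0 => x; exact: dens_ge0.
under eq_fun do rewrite e.
apply: cvgeZl => //.
apply: cvg_toP.
  apply: ereal_nondecreasing_is_cvgn => m n mn.
  apply: lee_sum_nneg_natr => // i _ _.
  by apply: integral_ge0 => x; exact: dens_ge0.
rewrite setI_bigcupl ge0_integral_bigcup//=.
- by move=> i; apply: measurableI; [exact: mF|exact: measurable_itv].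
- by rewrite -setI_bigcupl; exact: dens_meas.
- by move=> x; rewrite -setI_bigcupl; exact: dens_ge0.
- exact: trivIset_setIr.
Qed.

HB.instance Definition _ := isMeasure.Build _ _ _
  gauss gauss0 gauss_ge0 gauss_sigma_additive.

Lemma gauss_measure_itv0c (x : R) : 0 < x <= 1 ->
  gauss `[0, x] = (ln (1 + x) / ln 2)%:E.
Proof.
move=> /andP[x0 x1].
have der (y : R) : 0 <= y ->
    is_derive y (1 : R) (fun z : R => ln (1 + z)) (dens y).
  move=> y0.
  have y1 : 0 < 1 + y by rewrite ltr_pwDl.
  have := is_derive1_ln y1 => ?.
  have hD : is_derive y (1 : R) (fun z : R => 1 + z) (0 + 1).
    by apply: is_deriveD.
  rewrite -[dens y]mulr1 -[X in _ * X]add0r.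
  exact: (@is_derive1_comp _ (@ln R) (fun z => 1 + z) y).
have cont (y : R) : 0 <= y -> {for y, continuous (fun z : R => ln (1 + z))}.
  move=> y0; apply: differentiable_continuous.
  by apply/derivable1_diffP; case: (der y y0).
rewrite /gauss_measure setIidl; last first.
  by apply: subset_itvl; rewrite bnd_simp.
rewrite (@continuous_FTC2 R dens (fun z => ln (1 + z)))//.
- by rewrite addr0 ln1 sube0 -EFinM mulrC.
- apply: continuous_in_subspaceT => y; rewrite inE/= in_itv/= => /andP[y0 _].
  exact: dens_cont.
- split.
  + by move=> y; rewrite in_itv/= => /andP[/ltW /der[]].
  + exact/cvg_at_right_filter/cont.
  + exact/cvg_at_left_filter/cont/ltW.
- move=> y; rewrite in_itv/= => /andP[/ltW y0 _].
  by rewrite derive1E; have := der _ y0 => ?; rewrite derive_val.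
Qed.

Let gauss_setT : gauss [set: R] = 1%E.
Proof.
transitivity (gauss `[0, 1]); first by rewrite /gauss_measure setTI setIid.
by rewrite gauss_measure_itv0c ?ltr01 ?lexx// divff// gt_eqF.
Qed.

HB.instance Definition _ :=
  @Measure_isProbability.Build _ _ R gauss gauss_setT.

End gauss_measure.

(* Main.v *)
Require Import Defs.
From HB Require Import structures.
From mathcomp Require Import all_boot all_order all_algebra.
From mathcomp Require Import all_classical all_reals all_analysis.
From mathcomp Require Import measurable_realfun.
From mathcomp Require Import ring lra zify.

Set Implicit Arguments.
Unset Strict Implicit.
Unset Printing Implicit Defensive.

Import Order.TTheory GRing.Theory Num.Theory.
Import numFieldNormedType.Exports.

Local Open Scope classical_set_scope.
Local Open Scope ring_scope.

(* Let [nu s] be the law on ]0, 1[ with distribution function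
   (1 + s) x / (1 + s x), for 0 <= s <= 1; [nu 0] is Lebesgue measure.  If x has
   law [nu s] then, given that its first digit is a, T x has law
   [nu (1 / (a + s))].  Hence, given any number of digits, the next digit is at
   least k with probability between 1 / k and 2 / (k + 1), and the probability
   that n successive digits stay below k lies between (1 - 2 / (k + 1)) ^ n and
   (1 - 1 / k) ^ n; these correspond to the exponents (log 2) n and 2 (log 2) n
   in the two series.

   Let E_m be the event that T x, ..., T^m x all avoid B_m.
   Convergence: let E'_n be the event that B_n is avoided up to time
   n - n / D.  If E_m occurs, so does E'_n for m <= n <= m + m / D, so E_m
   infinitely often forces the sum of 1_{E'_n} / n to diverge, whereas its
   expectation is finite.
   Divergence: let a_i be the probability that no E_n with J <= n <= i occurs.
   If l <= n, then, up to an event of probability 2 l / (k_n + 1), B_n is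
   avoided up to time l, and then E_n has conditional probability at least
   p_n = (1 - 2 / (k_n + 1)) ^ n; so
     p_n (a_l - 2 l / (k_n + 1)) <= a_l - a_n.
   If a_i did not tend to 0, taking l of the order of k_n and summing over n
   with weights exp (- eps n / k_n) / n would bound the second series, as the
   windows [l, n] then have bounded weighted overlap. *)

(** * Measurability of the Gauss map and an affine change of variables *)

Lemma measurable_invr (R : realType) : measurable_fun [set: R] (fun x : R => x^-1).
Proof.
(* Away from 0 the right-hand side is [x / x ^ 2]; at 0 both sides vanish by the convention
   [0^-1 = 0]. *)
rewrite (_ : (fun x => x^-1) =
  (fun x : R => x * (`|x| `^ (-1) * `|x| `^ (-1)))); last first.
  apply/funext => x; rewrite powR_inv1//.
  have [->|x0] := eqVneq x 0; first by rewrite invr0 mul0r.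
  by rewrite -invfM -normrM ger0_norm ?sqr_ge0// invfM mulrA divff// mul1r.
have m : measurable_fun setT (fun x : R => `|x| `^ (-1)).
  by apply: (measurableT_comp (measurable_powR _)); exact: normr_measurable.
by apply: measurable_funM => //; exact: measurable_funM.
Qed.

Lemma measurable_preimageT (R : realType) (f : R -> R) (A : set R) :
  measurable_fun setT f -> measurable A -> measurable (f @^-1` A).
Proof. by move=> mf mA; rewrite -[X in measurable X]setTI; exact: mf. Qed.

Lemma measurable_gauss_map (R : realType) :
  measurable_fun [set: R] (@gauss_map R).
Proof.
have mfl : measurable_fun [set: R] (fun x : R => (Num.floor x)%:~R : R).
  apply: nondecreasing_measurable => // x y xy.
  by rewrite ler_int; exact: le_floor.
apply: measurable_fun_ifT => //.
  by apply: measurable_fun_eqr => //.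
by apply: measurable_funB; [|apply: measurableT_comp mfl _]; exact: measurable_invr.
Qed.

(** Both sides are measures of [A] that agree on half-open intervals. The substitution reverses
    orientation because the inverse branches of the Gauss map are decreasing. *)
Lemma lebesgue_measure_affine (R : realType) (c w : R) (A : set R) : 0 < w ->
  measurable A ->
  lebesgue_measure A =
    (w%:E * lebesgue_measure ((fun v : R => (c - w * v)%R) @^-1` A))%E.
Proof.
move=> w0 mA.
have mf : measurable_fun setT (fun v : R => c - w * v : measurableTypeR R).
  by apply: measurable_funB => //; exact: measurable_funM.
pose m := mscale (NngNum (ltW w0))
  (measure_function_pushforward__canonical__measure_function_Measure
    (@lebesgue_measure R) mf).
rewrite (@lebesgue_measure_unique R m)//= => _ [[a b]] _ <-.
rewrite /m /mscale/= /pushforward.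
have -> : (fun v : R => (c - w * v)%R) @^-1` `]a, b] =
    `[(c - b) / w, (c - a) / w[%classic.
  apply/seteqP; split => v /=; rewrite !in_itv/= ler_pdivrMr// ltr_pdivlMr//.
    by case/andP => h1 h2; apply/andP; split; lra.
  by case/andP => h1 h2; apply/andP; split; lra.
rewrite !lebesgue_measure_itv/= !lte_fin ltr_pM2r ?invr_gt0// ltrD2l ltrN2.
case: ifPn => _; last by rewrite mule0.
by rewrite -EFinD -EFinM; congr EFin; field; rewrite gt_eqF.
Qed.

(** * Conditional laws of the Gauss map given its first digits *)

Section gauss_family.
Context {R : realType}.
Implicit Types (s t u v : R) (A P Q : set R).
Local Notation leb := (@lebesgue_measure R).
Local Notation T := (@gauss_map R).

(* The inverse of the distribution function x |-> (1 + s) x / (1 + s x). *)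
Definition quantile s u : R := u / (1 + s - s * u).

Lemma measurable_quantile s : measurable_fun [set: R] (quantile s).
Proof.
apply: measurable_funM => //; apply: (measurableT_comp (@measurable_invr R)).
by apply: measurable_funB => //; exact: measurable_funM.
Qed.

Definition nu s : set R -> \bar R :=
  pushforward (mrestr leb (measurable_itv `]0, 1[%R)) (quantile s).

HB.instance Definition _ s := Measure.copy (nu s)
  (measure_function_pushforward__canonical__measure_function_Measure
    (mrestr leb (measurable_itv `]0, 1[%R)) (measurable_quantile s)).

Lemma nuE s A : nu s A = leb (quantile s @^-1` A `&` `]0, 1[).
Proof. by []. Qed.

Let nu_setT s : nu s setT = 1%E.
Proof.
by rewrite nuE preimage_setT setTI lebesgue_measure_itv/= lte_fin ltr01 oppr0 adde0.
Qed.

HB.instance Definition _ s :=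
  @Measure_isProbability.Build _ _ R (nu s) (nu_setT s).


(* In [branch], [cylinder] and the definitions below, the index [a] stands for
   the continued fraction digit a + 1. *)
Definition branch (a : nat) : R -> R := fun y => (a.+1%:R + y)^-1.

Definition cylinder (a : nat) : set R := `](a.+2%:R)^-1, (a.+1%:R)^-1]%classic.

Lemma measurable_branch a : measurable_fun [set: R] (branch a).
Proof.
by apply: (measurableT_comp (@measurable_invr R)); exact: measurable_funD.
Qed.

(** The [nu s]-mass of [cylinder a]. *)
Definition branch_weight a s : R := (1 + s) / ((a.+1%:R + s) * (a.+2%:R + s)).

(** The parameter of the law of [T x] given that [x], of law [nu s], lies in [cylinder a]. *)
Definition branch_param a s : R := (a.+1%:R + s)^-1.

Lemma branch_weight_gt0 a s : 0 <= s -> 0 < branch_weight a s.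
Proof.
by move=> s0; rewrite divr_gt0 ?mulr_gt0// ltr_pwDl// ltr0n.
Qed.

Lemma branch_param_itv a s : 0 <= s -> 0 <= branch_param a s <= 1.
Proof.
move=> s0; rewrite /branch_param invr_ge0 invf_le1 ?ltr_pwDl ?ltr0n//.
by rewrite addr_ge0//= ler_wpDr// ler1n.
Qed.

(** [branch_param a s] is the parameter for which the Möbius map from [v] to [u] is affine. It
    decreases from the value of the distribution function at the upper end of [cylinder a], with
    slope the mass of the cylinder. *)
Lemma quantile_affine a s v : 0 <= s <= 1 -> 0 <= v < 1 ->
  quantile s ((1 + s) / (a.+1%:R + s) - branch_weight a s * v) =
  branch a (quantile (branch_param a s) v).
Proof.
move=> /andP[s0 s1] /andP[v0 v1]; rewrite /quantile /branch /branch_weight /branch_param.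
have -> : a.+2%:R = a.+1%:R + 1 :> R by rewrite -natr1.
have : 1 <= a.+1%:R :> R by rewrite ler1n.
move: (a.+1%:R) => b b1.
have b0 : b + s != 0 by rewrite gt_eqF//; lra.
have h1 : b + 1 + s != 0 by rewrite gt_eqF//; lra.
have h2 : b + 1 + s - v != 0 by rewrite gt_eqF//; lra.
have sv : 0 <= s * v by exact: mulr_ge0.
have bb : 0 < b * b by apply: mulr_gt0; lra.
have bs : 0 <= b * s by apply: mulr_ge0; lra.
have h3 : b * (b + 1 + s) + s * v != 0 by rewrite gt_eqF//; lra.
have e1 : 1 + s - s * ((1 + s) / (b + s) - (1 + s) / ((b + s) * (b + 1 + s)) * v)
    = (1 + s) * (b * (b + 1 + s) + s * v) / ((b + s) * (b + 1 + s)).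
  by field; rewrite h1 b0.
have e2 : 1 + (b + s)^-1 - (b + s)^-1 * v = (b + 1 + s - v) / (b + s) by field.
have s10 : 1 + s != 0 by rewrite gt_eqF//; lra.
have h4 : b * (b + 1 + s - v) + v * (b + s) != 0.
  by rewrite (_ : _ + _ = b * (b + 1 + s) + s * v)//; ring.
by rewrite e1 e2; field; rewrite b0 h2 h4 h1 s10.
Qed.

Lemma quantile_le s u (b : R) : 0 <= s <= 1 -> 0 < u < 1 -> 0 < b ->
  (quantile s u <= b^-1) = (u <= (1 + s) / (b + s)).
Proof.
move=> /andP[s0 s1] /andP[u0 u1] b0; rewrite /quantile.
have su : s * u <= s by rewrite ler_piMr// ltW.
have d0 : 0 < 1 + s - s * u by lra.
have bs0 : 0 < b + s by lra.
rewrite ler_pdivrMr// [b^-1 * _]mulrC !ler_pdivlMr//.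
by rewrite -subr_ge0 -[RHS]subr_ge0; congr (0 <= _); ring.
Qed.

(** Cylinders are half-open and correspond to [0 <= v < 1], whereas [nu] uses the open interval; the
    extra endpoint is a null set. *)
Lemma lebesgue_measure_squeeze01 (X Y : set R) : measurable X -> measurable Y ->
  X `&` `]0, 1[ `<=` Y -> Y `<=` X `&` `[0, 1[ -> leb Y = leb (X `&` `]0, 1[).
Proof.
move=> mX mY XY YX.
have mXI : measurable (X `&` `]0, 1[%classic) by exact: measurableI.
apply/eqP; rewrite eq_le; apply/andP; split; last by apply: le_measure => //; rewrite inE.
have <- : leb ((X `&` `]0, 1[) `|` [set 0 : R]) = leb (X `&` `]0, 1[).
  by rewrite measureU0//; exact: lebesgue_measure_set1.
apply: le_measure; rewrite ?inE//.
  by apply: measurableU => //; exact: measurable_set1.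
move=> x /YX[Xx]; rewrite /= !in_itv/= => /andP[].
rewrite le_eqVlt => /predU1P[<- _|-> ->]; by [right|left].
Qed.

Lemma cylinder_quantile a s v : 0 <= s <= 1 ->
  let u := (1 + s) / (a.+1%:R + s) - branch_weight a s * v in
  0 < u < 1 -> cylinder a (quantile s u) <-> 0 <= v < 1.
Proof.
move=> s01 u u01; have /andP[s0 s1] := s01.
rewrite /cylinder/= in_itv/= ltNge !quantile_le ?ltr0n// -ltNge.
have w0 := branch_weight_gt0 a s0.
have -> : (1 + s) / (a.+2%:R + s) =
    (1 + s) / (a.+1%:R + s) - branch_weight a s.
  have a1 : 0 < a.+1%:R :> R by rewrite ltr0n.
  rewrite /branch_weight (_ : a.+2%:R = a.+1%:R + 1) -?[a.+2%:R]natr1//; field.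
  by rewrite !gt_eqF//; lra.
rewrite /u; split => /andP[h1 h2]; apply/andP; split.
- by rewrite -(pmulr_rge0 _ w0); lra.
- by rewrite -(ltr_pM2l w0) mulr1; lra.
- by rewrite ltrD2l ltrN2 gtr_pMr.
- by rewrite gerBl mulr_ge0// ltW.
Qed.

(** The substitution [u = c - w v] of [quantile_affine] maps [0, 1[ onto the values of [u] that
    belong to the cylinder. *)
Lemma nu_cylinderI a s A : 0 <= s <= 1 -> measurable A ->
  nu s (cylinder a `&` A) =
  ((branch_weight a s)%:E * nu (branch_param a s) (branch a @^-1` A))%E.
Proof.
move=> s01 mA; have /andP[s0 s1] := s01.
have w0 := branch_weight_gt0 a s0.
have mC : measurable (cylinder a) by exact: measurable_itv.
have mS : measurable (quantile s @^-1` (cylinder a `&` A) `&` `]0, 1[%classic).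
  apply: measurableI => //; apply: measurable_preimageT; first exact: measurable_quantile.
  exact: measurableI.
pose c := (1 + s) / (a.+1%:R + s).
rewrite !nuE (@lebesgue_measure_affine _ c _ _ w0)//; congr (_ * _)%E.
have a1 : 1 <= a.+1%:R :> R by rewrite ler1n.
have c1 : c <= 1 by rewrite /c ler_pdivrMr; lra.
have cw : 0 < c - branch_weight a s.
  rewrite /c /branch_weight (_ : _ - _ = (1 + s) / (a.+2%:R + s)).
    by rewrite divr_gt0// ltr_pwDl// ltr0n.
  rewrite -[a.+2%:R]natr1; field.
  by rewrite !gt_eqF//; lra.
apply: lebesgue_measure_squeeze01.
- apply: measurable_preimageT; first exact: measurable_quantile.
  by apply: measurable_preimageT => //; exact: measurable_branch.
- apply: measurable_preimageT => //; exact: measurable_funB.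
- move=> v [/= Av]; rewrite in_itv/= => v01.
  have v01' : 0 <= v < 1 by case/andP : v01 => /ltW -> ->.
  have u01 : 0 < c - branch_weight a s * v < 1.
    move: v01 => /andP[v0 v1].
    have := mulr_gt0 w0 v0.
    have : branch_weight a s * v < branch_weight a s by rewrite gtr_pMr.
    by move=> ? ?; apply/andP; split; lra.
  split; last by rewrite /= in_itv.
  split; first exact/cylinder_quantile.
  by rewrite quantile_affine.
- move=> v [/= [/= Cv Av]]; rewrite in_itv/= => u01.
  have [h _] := @cylinder_quantile a s v s01 u01.
  have v01 := h Cv.
  split; last by rewrite /= in_itv.
  by move: Av; rewrite /c quantile_affine.
Qed.

(** [quantile s] maps ]0, 1[ into itself, so [nu s] does not see the rest of the line. *)
Lemma eq_nu s A P : 0 <= s <= 1 -> (forall x, 0 < x < 1 -> A x <-> P x) ->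
  nu s A = nu s P.
Proof.
move=> /andP[s0 s1] AP; rewrite !nuE; congr (leb _).
suff q01 u : 0 < u < 1 -> 0 < quantile s u < 1.
  apply/seteqP; split => u [/= Au]; rewrite in_itv/= => u01;
    split => //=; rewrite ?in_itv//=; exact/(AP _ (q01 _ u01)).
move=> /andP[u0 u1]; rewrite /quantile.
have su : s * u <= s by rewrite ler_piMr// ltW.
have d0 : 0 < 1 + s - s * u by lra.
rewrite divr_gt0//= ltr_pdivrMr// mul1r.
rewrite -subr_gt0 (_ : _ - u = (1 - u) * (1 + s)); last by ring.
by apply: mulr_gt0; lra.
Qed.

Lemma trivIset_cylinder : trivIset setT cylinder.
Proof.
suff disj i j : (i < j)%N -> cylinder i `&` cylinder j = set0.
  apply/trivIsetP => i j _ _; rewrite neq_ltn => /orP[|] h; first exact: disj.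
  by rewrite setIC; exact: disj.
move=> ij; apply/seteqP; split => x //= [].
rewrite /cylinder/= !in_itv/= => /andP[h1 _] /andP[_ h2].
have := lt_le_trans h1 h2; rewrite ltf_pV2 ?posrE ?ltr0n// ltr_nat.
by rewrite !ltnS leqNgt ij.
Qed.

Lemma bigcup_cylinder x : 0 < x < 1 -> (\bigcup_a cylinder a) x.
Proof.
move=> /andP[x0 x1]; pose n := Num.truncn x^-1.
have xV : 1 < x^-1 by rewrite invf_gt1.
have := @truncn_itv _ x^-1 (ltW (lt_trans ltr01 xV)); rewrite -/n => /andP[n1 n2].
have n0 : (0 < n)%N by rewrite truncn_gt0 ltW.
exists n.-1 => //; rewrite /cylinder/= in_itv/= prednK//; apply/andP; split.
  by rewrite -[ltRHS]invrK ltf_pV2 ?posrE ?invr_gt0// ltr0n.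
by rewrite -[leLHS]invrK lef_pV2 ?posrE ?invr_gt0// ltr0n.
Qed.

(** Total probability over the first digit. *)
Lemma nu_branchE s A : 0 <= s <= 1 -> measurable A ->
  nu s A = (\sum_(0 <= a <oo)
    (branch_weight a s)%:E * nu (branch_param a s) (branch a @^-1` A))%E.
Proof.
move=> s01 mA.
have mC a : measurable (cylinder a `&` A).
  by apply: measurableI => //; exact: measurable_itv.
transitivity (nu s (\bigcup_a (cylinder a `&` A))).
  apply: eq_nu => // x x01; split=> [Ax|[a _ []]//].
  by have [a _ ax] := bigcup_cylinder x01; exists a.
rewrite measure_semi_bigcup//.
- by apply: eq_eseriesr => a _; exact: nu_cylinderI.
- exact/trivIset_setIr/trivIset_cylinder.
- exact: bigcup_measurable.
Qed.

Lemma gauss_map_branch a y : 0 <= y < 1 -> T (branch a y) = y.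
Proof.
move=> /andP[y0 y1]; rewrite /gauss_map /branch invr_eq0 invrK.
rewrite gt_eqF ?ltr_pwDl ?ltr0n//.
have -> : Num.floor (a.+1%:R + y) = Posz a.+1.
  by apply/eqP; rewrite floor_eq; apply/andP; split; rewrite ?intrD//; lra.
by rewrite addrC addKr.
Qed.

Lemma branch_itv a y : 0 < y < 1 -> 0 < branch a y < 1.
Proof.
move=> /andP[y0 y1]; have a1 : 1 <= a.+1%:R :> R by rewrite ler1n.
by rewrite /branch invr_gt0 invf_lt1; [apply/andP; split|]; lra.
Qed.

(* Whether [x] lies in [P] depends only on the first [n] continued fraction
   digits of [x]. *)
Fixpoint digit_determined (n : nat) P : Prop :=
  if n is n'.+1 then forall a, digit_determined n' (branch a @^-1` P)
  else (forall x, 0 < x < 1 -> P x) \/ (forall x, 0 < x < 1 -> ~ P x).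

Lemma measurable_iter_gauss_map n : measurable_fun setT (iter n T).
Proof.
elim: n => [|n ih]; first exact: measurable_id.
exact: measurableT_comp (@measurable_gauss_map R) ih.
Qed.

(* A digit event of order [n] is, under every law of the family, nearly
   independent of what happens from time [n] on, because conditioning on the
   first [n] digits leads back to a law of the family. *)
Lemma nu_digit_determinedI n s P Q (p q : R) : 0 <= s <= 1 ->
  digit_determined n P -> measurable P -> measurable Q ->
  0 <= p -> 0 <= q ->
  (forall t, 0 <= t <= 1 -> (p%:E <= nu t Q <= q%:E)%E) ->
  (p%:E * nu s P <= nu s (P `&` iter n T @^-1` Q) <= q%:E * nu s P)%E.
Proof.
move=> s01 + mP mQ p0 q0 pQ; elim: n s P s01 mP => [|n ih] s P s01 mP /=.
  case=> hP.
    rewrite (@eq_nu s P setT)// ?(@eq_nu s (P `&` _) Q)//.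
    - by rewrite probability_setT !mule1; exact: pQ.
    - by move=> x /hP Px; split=> [[]//|].
    - by move=> x /hP Px; split.
  rewrite (@eq_nu s P set0)// ?(@eq_nu s (P `&` _) set0)//.
  - by rewrite measure0 !mule0 lexx.
  - by move=> x /hP Px; split=> [[]//|].
  - by move=> x /hP Px; split.
move=> dP.
have mB a (A : set R) : measurable A -> measurable (branch a @^-1` A).
  by move=> mA; apply: measurable_preimageT => //; exact: measurable_branch.
have mTQ m : measurable (iter m T @^-1` Q).
  by apply: measurable_preimageT => //; exact: measurable_iter_gauss_map.
have s0 : 0 <= s by case/andP : s01.
have := fun a => ih (branch_param a s) (branch a @^-1` P) (branch_param_itv a s0)
  (mB a P mP) (dP a).
(* Expanding over the first digit uses up one application of [T], since [T] inverts each branch. *)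
have -> : nu s (P `&` (fun x => T (iter n T x)) @^-1` Q) =
  (\sum_(0 <= a <oo) (branch_weight a s)%:E *
    nu (branch_param a s) (branch a @^-1` P `&` iter n T @^-1` Q))%E.
  rewrite nu_branchE//; last by apply: measurableI => //; exact: (mTQ n.+1).
  apply: eq_eseriesr => a _; congr (_ * _)%E; apply: eq_nu.
    exact: branch_param_itv.
  move=> y y01; rewrite /= -iterS iterSr gauss_map_branch//.
  by case/andP : y01 => /ltW -> ->.
rewrite (nu_branchE s01 mP) => ihs.
have w0 a : (0 <= (branch_weight a s)%:E)%E.
  by rewrite lee_fin; exact/ltW/branch_weight_gt0.
rewrite -!nneseriesZl; try by move=> a _; exact: mule_ge0.
apply/andP; split; apply: lee_nneseries.
- by move=> a _ _; rewrite !mule_ge0.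
- by move=> a _; rewrite muleCA; apply: lee_wpmul2l => //; case/andP: (ihs a).
- by move=> a _ _; rewrite !mule_ge0.
- by move=> a _; rewrite [leRHS]muleCA; apply: lee_wpmul2l => //; case/andP: (ihs a).
Qed.

End gauss_family.

(** * Probability of avoiding a target *)

Section no_hit.
Context {R : realType}.
Implicit Types (s t : R) (A P Q : set R) (k l m n : nat).
Local Notation T := (@gauss_map R).

Lemma digit_determinedC n P : digit_determined n P -> digit_determined n (~` P).
Proof.
elim: n P => [|n ih] P /=; last by move=> h a; exact: (ih (branch a @^-1` P)).
by case=> h; [right|left] => x x01 /=; have := h _ x01; tauto.
Qed.

Lemma digit_determined_bigcap n (I : Type) (D : set I) (F : I -> set R) :
  (forall i, D i -> digit_determined n (F i)) ->
  digit_determined n (\bigcap_(i in D) F i).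
Proof.
elim: n F => [|n ih] F /= dF; last first.
  by move=> a; apply: (ih (fun i => branch a @^-1` F i)) => i /dF; exact.
have [[i [Di Fi]]|h] :=
    pselect (exists i, D i /\ forall x, 0 < x < 1 -> ~ F i x).
  by right=> x x01 /(_ i Di); exact: Fi.
left=> x x01 i Di; case: (dF i Di) => [|Fi]; first exact.
by exfalso; apply: h; exists i.
Qed.

Lemma eq_digit_determined n P Q : (forall x, 0 < x < 1 -> P x <-> Q x) ->
  digit_determined n P -> digit_determined n Q.
Proof.
elim: n P Q => [|n ih] P Q PQ /=.
  by case=> h; [left|right] => x x01; have := h _ x01; rewrite PQ.
move=> dP a; apply: ih (dP a) => y y01; apply: PQ; exact: branch_itv.
Qed.

Lemma digit_determined_leq m n P : (m <= n)%N ->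
  digit_determined m P -> digit_determined n P.
Proof.
elim: n m P => [|n ih] [|m] P //=; last by move=> mn dP a; exact: ih (dP a).
move=> _ h a; apply: (ih 0%N) => //=.
by case: h => h; [left|right] => y y01; apply: h; exact: branch_itv.
Qed.

Lemma digit_determined_iter n m P : digit_determined n P ->
  digit_determined (m + n) (iter m T @^-1` P).
Proof.
move=> dP; elim: m => [//|m ih] a.
apply: eq_digit_determined ih => y y01; rewrite /preimage/= -iterS iterSr.
by rewrite gauss_map_branch//; case/andP : y01 => /ltW -> ->.
Qed.

Definition target k : set R := `[0, k%:R^-1]%classic.

Lemma measurable_target k : measurable (target k).
Proof. exact: measurable_itv. Qed.

(** In ]0, 1[, the target consists of the points whose first digit is at least [k], up to the
    boundary point [1 / k], which is not of the form [branch a y] with [0 < y < 1]. *)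
Lemma digit_determined_target k : (0 < k)%N -> digit_determined 1 (target k).
Proof.
move=> k0 a /=; have [ka|ak] := leqP k a.+1; [left|right]=> y y01;
    have /andP[y0 y1] := y01; have /andP[b0 b1] := branch_itv a y01;
    rewrite /target /= in_itv/= (ltW b0)/= /branch.
  by rewrite lef_pV2 ?posrE ?ltr_pwDl ?ltr0n ?(ltW y0)// ler_wpDr ?ler_nat// ltW.
rewrite lef_pV2 ?posrE ?ltr_pwDl ?ltr0n ?(ltW y0)//; apply/negP; rewrite -ltNge.
by rewrite (@lt_le_trans _ _ a.+2%:R) ?ler_nat// -[ltRHS]natr1 ltrD2l.
Qed.

Lemma nu_target s k : 0 <= s <= 1 -> (0 < k)%N ->
  nu s (target k) = ((1 + s) / (k%:R + s))%:E.
Proof.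
move=> s01 k0; have /andP[s0 s1] := s01; set c := (1 + s) / _.
have k1 : 1 <= k%:R :> R by rewrite ler1n.
have ks : 0 < k%:R + s by lra.
have c0 : 0 < c by rewrite divr_gt0//; lra.
have c1 : c <= 1 by rewrite ler_pdivrMr//; lra.
rewrite (@eq_nu _ s _ `]-oo, k%:R^-1]%classic)//; last first.
  move=> x /andP[x0 _]; rewrite /target/= !in_itv/=.
  by split => [/andP[]//|->]; rewrite (ltW x0).
have qc u : 0 < u < 1 -> (quantile s u <= k%:R^-1) = (u <= c).
  by move=> u01; rewrite quantile_le// ltr0n.
have mS : measurable
    (quantile s @^-1` `]-oo, k%:R^-1]%classic `&` `]0, 1[%classic).
  apply: measurableI => //.
  by apply: measurable_preimageT => //; exact: measurable_quantile.
rewrite nuE; apply/eqP; rewrite eq_le; apply/andP; split.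
  have -> : c%:E = lebesgue_measure (`]0, c]%classic : set R).
    by rewrite lebesgue_measure_itv/= lte_fin c0 oppr0 adde0.
  apply: le_measure; rewrite ?inE//.
  by move=> u [/=]; rewrite !in_itv/= => qu /andP[u0 u1]; rewrite u0/= -qc ?u0.
have -> : c%:E = lebesgue_measure (`]0, c[%classic : set R).
  by rewrite lebesgue_measure_itv/= lte_fin c0 oppr0 adde0.
apply: le_measure; rewrite ?inE//.
move=> u /=; rewrite in_itv/= => /andP[u0 uc].
have u1 : u < 1 by lra.
by split => /=; rewrite in_itv/= ?u0// qc ?u0// ltW.
Qed.

(** [(1 + s) / (k + s)] increases with [s]; the bounds are its values at 0 and 1. *)
Lemma nu_target_bounds s k : 0 <= s <= 1 -> (0 < k)%N ->
  ((k%:R^-1)%:E <= nu s (target k) <= (2 / (k%:R + 1))%:E)%E.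
Proof.
move=> s01 k0; have /andP[s0 s1] := s01; rewrite nu_target// !lee_fin.
have k1 : 1 <= k%:R :> R by rewrite ler1n.
apply/andP; split.
  rewrite ler_pdivlMr; last lra.
  rewrite mulrDr mulVf ?lerD2l; last by rewrite gt_eqF//; lra.
  by rewrite ler_piMl// invf_le1; lra.
rewrite ler_pdivrMr; last lra.
rewrite mulrAC ler_pdivlMr; last lra.
have : 0 <= (1 - s) * (k%:R - 1) by apply: mulr_ge0; lra.
lra.
Qed.

Lemma nu_targetC_bounds s k : 0 <= s <= 1 -> (0 < k)%N ->
  ((1 - 2 / (k%:R + 1))%:E <= nu s (~` target k) <= (1 - k%:R^-1)%:E)%E.
Proof.
move=> s01 k0; have := nu_target_bounds s01 k0.
rewrite probability_setC; last exact: measurable_target.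
rewrite /= nu_target// -(EFinB 1 ((1 + s) / (k%:R + s))) !lee_fin => /andP[h1 h2]; apply/andP; split; lra.
Qed.

Definition no_hit k l m : set R :=
  \bigcap_(j in [set j | (l <= j < m)%N]) (iter j T @^-1` (~` target k)).

Lemma measurable_no_hit k l m : measurable (no_hit k l m).
Proof.
apply: bigcap_measurableType => j _; apply: measurable_preimageT.
  exact: measurable_iter_gauss_map.
by apply: measurableC; exact: measurable_target.
Qed.

Lemma digit_determined_no_hit k l m : (0 < k)%N ->
  digit_determined m (no_hit k l m).
Proof.
move=> k0; apply: digit_determined_bigcap => j /= /andP[_ jm].
apply: (@digit_determined_leq (j + 1)); first by rewrite addn1.
exact/digit_determined_iter/digit_determinedC/digit_determined_target.
Qed.

Lemma no_hit_split k l i m : (l <= i <= m)%N ->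
  no_hit k l m = no_hit k l i `&` iter i T @^-1` no_hit k 0 (m - i).
Proof.
move=> /andP[li im]; apply/seteqP; split => x.
  move=> h; split=> j /= jh; first by apply: h => /=; lia.
  by rewrite /preimage/= -iterD; apply: h => /=; lia.
move=> [h1 h2] j /= jh; have [ji|ij] := ltnP j i; first by apply: h1 => /=; lia.
have := h2 (j - i)%N; rewrite /preimage/= -iterD subnK//; apply; lia.
Qed.

(** Induction on [n], splitting off time 0. The bounds are uniform in [s], so they apply to
    whichever law arises after the first digit. *)
Lemma nu_no_hit_bounds s k n : 0 <= s <= 1 -> (0 < k)%N ->
  (((1 - 2 / (k%:R + 1)) ^+ n)%:E <= nu s (no_hit k 0 n)
    <= ((1 - k%:R^-1) ^+ n)%:E)%E.
Proof.
move=> s01 k0; have k1 : 1 <= k%:R :> R by rewrite ler1n.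
have p0 : 0 <= 1 - 2 / (k%:R + 1) :> R.
  by rewrite subr_ge0 ler_pdivrMr; lra.
have q0 : 0 <= 1 - k%:R^-1 :> R by rewrite subr_ge0 invf_le1//; lra.
elim: n s s01 => [|n ih] s s01.
  rewrite (_ : no_hit k 0 0 = setT) ?probability_setT ?expr0 ?lexx//.
  by rewrite -subTset => x _ j /=.
rewrite (@no_hit_split k 0 1 n.+1)// subSS subn0.
have /andP[h1 h2] := nu_digit_determinedI s01
  (@digit_determined_no_hit k 0 1 k0) (@measurable_no_hit k 0 1)
  (@measurable_no_hit k 0 n) (exprn_ge0 n p0) (exprn_ge0 n q0) ih.
have e : no_hit k 0 1 = ~` target k.
  apply/seteqP; split => x; first by move/(_ 0%N); apply.
  by move=> h [|j].
move: h1 h2; rewrite e => h1 h2.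
have /andP[t1 t2] := nu_targetC_bounds s01 k0.
rewrite !exprSr !EFinM; apply/andP; split.
  by apply: le_trans h1; apply: lee_wpmul2l => //; rewrite lee_fin exprn_ge0.
by apply: (le_trans h2); apply: lee_wpmul2l => //; rewrite lee_fin exprn_ge0.
Qed.

(** Conditioning on the first [j] digits reduces to time 0; the digit event is here the sure
    event. *)
Lemma nu_hit_le s k j : 0 <= s <= 1 -> (0 < k)%N ->
  (nu s (iter j T @^-1` target k) <= (2 / (k%:R + 1))%:E)%E.
Proof.
move=> s01 k0.
have dT : digit_determined j [set: R].
  by apply: (@digit_determined_leq 0) => //; left.
have q0 : 0 <= 2 / (k%:R + 1) :> R by rewrite divr_ge0// addr_ge0.
have h t : 0 <= t <= 1 -> (0%:E <= nu t (target k) <= (2 / (k%:R + 1))%:E)%E.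
  by move=> t01; case/andP: (nu_target_bounds t01 k0) => _ ->; rewrite measure_ge0.
have := nu_digit_determinedI s01 dT measurableT (measurable_target k)
  (lexx 0) q0 h.
by rewrite setTI probability_setT !mule1 => /andP[].
Qed.

End no_hit.

(** * Targets missed infinitely often *)

Lemma expRN_le_inv (R : realType) (x : R) : 0 < x -> expR (- x) <= x^-1.
Proof.
move=> x0; rewrite expRN lef_pV2 ?posrE ?expR_gt0//.
by apply: le_trans (expR_ge1Dx x); rewrite lerDr.
Qed.

Lemma sum_inv_sqr_le (R : realType) (L N : nat) : (0 < L)%N ->
  \sum_(L <= n < N) (n%:R ^+ 2)^-1 <= 2 / L%:R :> R.
Proof.
move=> L0; have [NL|LN] := leqP N L; first by rewrite big_geq// divr_ge0.
(* The difference [2 / n - 2 / (n + 1)] is [2 / (n (n + 1))], at least [1 / n ^ 2] for [n >= 1]. *)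
apply: (@le_trans _ _ (\sum_(L <= n < N) ((- 2 / n.+1%:R) - (- 2 / n%:R)))).
  rewrite big_nat_cond [leRHS]big_nat_cond; apply: ler_sum => n.
  rewrite andbT => /andP[Ln _].
  have n1 : 1 <= n%:R :> R by rewrite ler1n (leq_trans L0).
  rewrite -[n.+1%:R]natr1 -subr_ge0.
  have -> : - 2 / (n%:R + 1) - - 2 / n%:R - (n%:R ^+ 2)^-1 =
      (n%:R - 1) / (n%:R ^+ 2 * (n%:R + 1)) :> R.
    by field; rewrite !gt_eqF//; lra.
  by rewrite divr_ge0 ?mulr_ge0 ?sqr_ge0//; lra.
rewrite telescope_sumr 1?ltnW// !mulNr opprK.
by rewrite gerDr oppr_le0 divr_ge0.
Qed.

(* Summation by parts: the increments of [a] over the windows [[l n, n]], with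
   [l n] about [del / 4 * k n], overlap so little, when weighted by
   [exp (- eps n / k n) / n], that the total is controlled by [a 0]. *)
Lemma bounded_sum_of_decrements (R : realType) (a t : nat -> R)
    (k : nat -> nat) (J : nat) (eps del : R) :
  0 < eps -> 0 < del -> (0 < J)%N ->
  (forall n, del <= a n) -> (forall n, a n <= 1) -> (forall n, a n.+1 <= a n) ->
  (forall n, (J <= n)%N -> (0 < k n)%N) ->
  (forall n, (J <= n)%N -> 0 <= t n <=
    (1 - 2 / ((k n)%:R + 1)) ^+ n * expR (- (eps * n%:R / (k n)%:R))) ->
  (forall n l, (J <= n)%N -> (l <= n)%N ->
    (1 - 2 / ((k n)%:R + 1)) ^+ n * (a l - l%:R * (2 / ((k n)%:R + 1)))
      <= a l - a n) ->
  exists C, forall N, \sum_(J <= n < N) t n / n%:R <= C.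
Proof.
move=> eps0 del0 J0 ad a1 adec k0 ht step.
(* With this [eta] the loss [l n * 2 / (k n + 1)] in [step] is at most [del / 2]; the minimum
   ensures [l n <= n]. *)
pose eta := del / 4; have eta0 : 0 < eta by rewrite divr_gt0.
pose l n := minn n (Num.truncn (eta * (k n)%:R)).
pose d i := a i - a i.+1.
have d0 i : 0 <= d i by rewrite subr_ge0.
pose w n := expR (- (eps * n%:R / (k n)%:R)) / n%:R.
have w0 n : 0 <= w n by rewrite divr_ge0// expR_ge0.
have hp n : (J <= n)%N ->
    (1 - 2 / ((k n)%:R + 1)) ^+ n * (del / 2) <= \sum_(l n <= i < n) d i.
  move=> Jn; have ln : (l n <= n)%N by exact: geq_minl.
  have k1 : 1 <= (k n)%:R :> R by rewrite ler1n k0.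
  have -> : \sum_(l n <= i < n) d i = a (l n) - a n.
    rewrite -[RHS]opprB -telescope_sumr// -sumrN.
    by apply: eq_bigr => i _; rewrite opprB.
  apply: le_trans (step n (l n) Jn ln); apply: ler_wpM2l.
    by rewrite exprn_ge0// subr_ge0 ler_pdivrMr; lra.
  have : (l n)%:R * (2 / ((k n)%:R + 1)) <= del / 2.
    rewrite mulrA ler_pdivrMr; last lra.
    have : (l n)%:R <= eta * (k n)%:R.
      rewrite (@le_trans _ _ (Num.truncn (eta * (k n)%:R))%:R)//.
        by rewrite ler_nat geq_minr.
      by rewrite truncn_le mulr_ge0// ltW.
    by rewrite /eta => h; lra.
  by have := ad (l n); lra.
pose C1 := 2 / (eps * eta).
(* If the window of [n] contains [i], then [eta * k n < i + 1], so [exp (- y) <= 1 / y] bounds its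
   weight by a multiple of [(i + 1) / n ^ 2]. Summing over [n > i] gives a bound independent of
   [i]. *)
have hC1 i N : \sum_(J <= n < N | (l n <= i < n)%N) w n <= C1.
  pose L : R := i.+1%:R; have L0 : 0 < L by rewrite ltr0n.
  apply: (@le_trans _ _ (\sum_(i.+1 <= n < N) (L / (eps * eta)) * (n%:R ^+ 2)^-1)).
    rewrite [leRHS](big_nat_widenl _ 0)// (big_nat_widenl J 0)//.
    rewrite [leLHS]big_mkcond [leRHS]big_mkcond/=; apply: ler_sum => n _.
    case: ifPn => [/andP[/andP[ln iltn] Jn]|_]; last first.
      case: ifP => // _.
      by rewrite mulr_ge0 ?invr_ge0 ?sqr_ge0// divr_ge0 ?mulr_ge0// ltW.
    rewrite iltn.
    have n0 : 0 < n%:R :> R by rewrite ltr0n; lia.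
    have kn : 0 < (k n)%:R :> R by rewrite ltr0n k0.
    have kL : eta * (k n)%:R < L.
      rewrite /L -truncn_le_nat.
      by move: ln; rewrite /l geq_min leqNgt iltn.
    have -> : L / (eps * eta) * (n%:R ^+ 2)^-1 = L / (eps * eta) / n%:R / n%:R.
      by field; rewrite !gt_eqF.
    rewrite /w ler_wpM2r ?invr_ge0 ?(ltW n0)//.
    apply: le_trans (expRN_le_inv _) _; first by rewrite divr_gt0// mulr_gt0.
    have -> : (eps * n%:R / (k n)%:R)^-1 =
        eta * (k n)%:R * (eps * eta * n%:R)^-1.
      by field; rewrite !gt_eqF.
    have -> : L / (eps * eta) / n%:R = L * (eps * eta * n%:R)^-1.
      by field; rewrite !gt_eqF.
    by rewrite ler_wpM2r ?invr_ge0 ?mulr_ge0// ltW.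
  rewrite -mulr_sumr; apply: (le_trans (ler_wpM2l _ (sum_inv_sqr_le R N _))) => //.
    by rewrite divr_ge0 ?mulr_ge0// ltW.
  by rewrite /C1 -/L le_eqVlt; apply/orP; left; apply/eqP; field; rewrite !gt_eqF.
exists (2 / del * C1) => N.
have C10 : 0 <= C1 by rewrite divr_ge0 ?mulr_ge0 ?ltW.
apply: (@le_trans _ _ (2 / del *
    \sum_(J <= n < N) \sum_(0 <= i < N | (l n <= i < n)%N) d i * w n)).
  rewrite mulr_sumr big_nat_cond [leRHS]big_nat_cond; apply: ler_sum => n.
  rewrite andbT => /andP[Jn nN].
  have -> : \sum_(0 <= i < N | (l n <= i < n)%N) d i * w n =
      (\sum_(l n <= i < n) d i) * w n.
    rewrite -mulr_suml; congr (_ * _); apply/esym.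
    rewrite (big_nat_widen _ _ N) 1?ltnW// (big_nat_widenl _ 0)//.
    by apply: eq_bigl => i; rewrite andbC.
  have n0 : 0 < n%:R :> R by rewrite ltr0n (leq_trans J0).
  have /andP[_ tn] := ht n Jn.
  rewrite /w mulrA [leRHS]mulrA ler_wpM2r ?invr_ge0 ?(ltW n0)//.
  apply: (le_trans tn); rewrite mulrA ler_wpM2r ?expR_ge0//.
  have := ler_wpM2l _ (hp n Jn) => /(_ (2 / del) _) h.
  apply: le_trans (h _); last by rewrite divr_ge0// ltW.
  rewrite le_eqVlt; apply/orP; left; apply/eqP; field.
  by rewrite gt_eqF.
apply: ler_wpM2l; first by rewrite divr_ge0// ltW.
under eq_bigr do rewrite big_mkcond.
(* Each decrement now carries total weight at most [C1], and the decrements telescope to at most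
   1. *)
rewrite exchange_big/=.
apply: (@le_trans _ _ (\sum_(0 <= i < N) d i * C1)).
  apply: ler_sum => i _; rewrite -big_mkcond -mulr_sumr.
  exact: ler_wpM2l.
rewrite -mulr_suml ler_piMl//.
have -> : \sum_(0 <= i < N) d i = a 0%N - a N.
  rewrite -[RHS]opprB -telescope_sumr// -sumrN.
  by apply: eq_bigr => i _; rewrite opprB.
have := a1 0%N; have := ad N; lra.
Qed.

Section misses.
Context {R : realType}.
Context (k : nat -> nat) (k_gt0 : forall n, (0 < n)%N -> (0 < k n)%N).
Local Notation T := (@gauss_map R).
Local Notation P0 := (@nu R 0).

(** The event E_n: the half-open range stands for the times 1 to [n], those of [orbit_segment]. *)
Definition missed n : set R := no_hit (k n) 1 n.+1.

Definition never_missed J i : set R :=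
  \bigcap_(n in [set n | (J <= n <= i)%N]) (~` missed n).

Lemma measurable_missed n : measurable (missed n).
Proof. exact: measurable_no_hit. Qed.

Lemma measurable_never_missed J i : measurable (never_missed J i).
Proof.
apply: bigcap_measurableType => n _.
by apply: measurableC; exact: measurable_missed.
Qed.

Lemma digit_determined_never_missed J i : (0 < J)%N ->
  digit_determined i.+1 (never_missed J i).
Proof.
move=> J0; apply: digit_determined_bigcap => n /andP[Jn ni].
apply: digit_determinedC; apply: (@digit_determined_leq _ n.+1) => //.
by apply: digit_determined_no_hit; apply: k_gt0; exact: leq_trans Jn.
Qed.

Lemma nu0_hit_le m l : (0 < m)%N ->
  (P0 (~` no_hit m 1 l.+1) <= (l%:R * (2 / (m%:R + 1)))%:E)%E.
Proof.
move=> m0.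
have -> : ~` no_hit m 1 l.+1 = \big[setU/set0]_(j < l) (iter j.+1 T @^-1` target m).
  rewrite -(bigcup_mkord l (fun j => iter j.+1 T @^-1` target m)).
  rewrite /no_hit setC_bigcap; apply/seteqP; split => x.
    case=> -[//|j] /= jl /contrapT h; exists j => //=.
  by case=> j /= jl h; exists j.+1; [rewrite /= ; lia|exact].
have mt j : measurable (iter j.+1 T @^-1` target m).
  by apply: measurable_preimageT; [exact: (@measurable_iter_gauss_map R j.+1)|
    exact: measurable_target].
apply: (le_trans (@le_mu_bigsetU _ _ _ P0
  (fun j => iter j.+1 T @^-1` target m) l _)) => //.
apply: (@le_trans _ _ (\sum_(i < l) (2 / (m%:R + 1))%:E)%E).
  apply: lee_sum => i _; apply: (@nu_hit_le R 0 m i.+1) => //.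
  by rewrite lexx ler01.
by rewrite sumEFin sumr_const card_ord -[_ *+ l]mulr_natl.
Qed.

Lemma never_missed_step J n l : (0 < J)%N -> (J <= n)%N -> (l <= n)%N ->
  (1 - 2 / ((k n)%:R + 1)) ^+ n *
    (fine (P0 (never_missed J l)) - l%:R * (2 / ((k n)%:R + 1))) <=
  fine (P0 (never_missed J l)) - fine (P0 (never_missed J n)).
Proof.
move=> J0 Jn ln; set p := 1 - _.
have s0 : (0 : R) <= (0 : R) <= 1 by apply/andP; split.
have kn : (0 < k n)%N by apply: k_gt0; exact: leq_trans Jn.
have k1 : 1 <= (k n)%:R :> R by rewrite ler1n.
have p0 : 0 <= p by rewrite subr_ge0 ler_pdivrMr; lra.
have p1 : p <= 1 by rewrite gerBl divr_ge0//; lra.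
set M := never_missed J; pose G : set R := no_hit (k n) 1 l.+1.
pose F : set R := no_hit (k n) 0 (n - l).
have mM i : measurable (M i) by exact: measurable_never_missed.
have mG : measurable G by exact: measurable_no_hit.
have mF : measurable F by exact: measurable_no_hit.
(* [G] covers the times 1 to [l]; the [n - l] times from [l + 1] to [n] are left to [F]. *)
have missedE : missed n = G `&` iter l.+1 T @^-1` F.
  by rewrite /missed (@no_hit_split _ _ 1 l.+1)//= ltnS.
have dMG : digit_determined l.+1 (M l `&` G).
  have -> : M l `&` G = \bigcap_(b in [set: bool]) (if b then M l else G).
    apply/seteqP; split => x; first by move=> [? ?] [].
    by move=> h; split; [exact: (h true)|exact: (h false)].
  apply: digit_determined_bigcap => -[] _; first exact: digit_determined_never_missed.
  exact: digit_determined_no_hit.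
have fin A : measurable A -> P0 A = (fine (P0 A))%:E.
  by move=> mA; rewrite fineK// fin_num_measure.
have mMG : measurable (M l `&` G) by exact: measurableI.
have mML i : measurable (M i `&` missed n).
  by apply: measurableI => //; exact: measurable_missed.
have h1 : fine (P0 (M l)) <=
    fine (P0 (M l `&` G)) + l%:R * (2 / ((k n)%:R + 1)).
  rewrite -lee_fin EFinD -!fin//.
  apply: (@le_trans _ _ (P0 ((M l `&` G) `|` ~` G))).
    apply: le_measure; rewrite ?inE//.
      by apply: measurableU => //; exact: measurableC.
    by move=> x Mx; have [Gx|Gx] := pselect (G x); [left|right].
  apply: (le_trans (@measureU2 _ _ _ P0 _ _ mMG (measurableC mG))).
  by apply: leeD => //; exact: nu0_hit_le.
have h2 : p ^+ n * fine (P0 (M l `&` G)) <= fine (P0 (M l `&` missed n)).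
  apply: (@le_trans _ _ (p ^+ (n - l) * fine (P0 (M l `&` G)))).
    by apply: ler_wpM2r; [rewrite fine_ge0|rewrite ler_wiXn2l ?leq_subr].
  rewrite -lee_fin EFinM -!fin// missedE setIA.
  have hF t : 0 <= t <= 1 -> ((p ^+ (n - l))%:E <= nu t F <= 1%:E)%E.
    move=> t01; case/andP: (nu_no_hit_bounds (n - l) t01 kn) => -> _ /=.
    exact: probability_le1.
  by case/andP: (nu_digit_determinedI s0 dMG mMG mF (exprn_ge0 _ p0) ler01 hF).
(* Points of [M l] in [missed n] do not belong to [M n], as [J <= n]. *)
have h3 : fine (P0 (M n)) + fine (P0 (M l `&` missed n)) <= fine (P0 (M l)).
  rewrite -lee_fin EFinD -!fin// (@measureDI _ _ _ P0 (M l) (missed n))//; last first.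
    exact: measurable_missed.
  apply: leeD => //; apply: le_measure; rewrite ?inE//.
    by apply: measurableD => //; exact: measurable_missed.
  move=> x h; split; last by apply: (h n); rewrite /= Jn leqnn.
  by move=> i /= /andP[Ji il]; apply: h; rewrite /= Ji (leq_trans il).
have h4 := ler_wpM2l (exprn_ge0 n p0) h1.
by move: h4; rewrite mulrDr mulrBr; lra.
Qed.

Lemma nu0_never_missed (t : nat -> R) (eps : R) J : 0 < eps -> (0 < J)%N ->
  (forall n, (J <= n)%N -> 0 <= t n <=
    (1 - 2 / ((k n)%:R + 1)) ^+ n * expR (- (eps * n%:R / (k n)%:R))) ->
  (forall C, exists N, C < \sum_(J <= n < N) t n / n%:R) ->
  P0 (\bigcap_i never_missed J i) = 0%E.
Proof.
move=> eps0 J0 ht tdiv; pose a i := fine (P0 (never_missed J i)).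
have mM i : measurable (never_missed J i) by exact: measurable_never_missed.
have aE i : P0 (never_missed J i) = (a i)%:E.
  by rewrite /a fineK// fin_num_measure.
have mI : measurable (\bigcap_i never_missed J i) by exact: bigcapT_measurable.
apply/eqP; rewrite eq_le measure_ge0 andbT; apply/lee_addgt0Pr => del del0.
rewrite add0e.
(* Otherwise all the probabilities are at least [del], and [bounded_sum_of_decrements] contradicts
   the divergence. *)
have [[i ai]|h] := pselect (exists i, a i < del).
  apply: (@le_trans _ _ (P0 (never_missed J i))).
    by apply: le_measure; rewrite ?inE//; exact: bigcap_inf.
  by rewrite aE lee_fin ltW.
have := @bounded_sum_of_decrements R a t k J eps del eps0 del0 J0.
case=> //.
- by move=> n; rewrite leNgt; apply/negP => an; apply: h; exists n.
- by move=> n; rewrite -lee_fin -aE; exact: probability_le1.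
- move=> n; rewrite -lee_fin -!aE; apply: le_measure; rewrite ?inE//.
  by move=> x hx m /= /andP[Jm mn]; apply: hx; rewrite /= Jm leqW.
- by move=> n Jn; apply: k_gt0; exact: leq_trans Jn.
- by move=> n l Jn ln; exact: never_missed_step.
- by move=> C hC; have [N] := tdiv C; rewrite ltNge hC.
Qed.

End misses.

(** * Targets missed finitely often *)

(** A weighted Borel-Cantelli lemma: the random sum has finite integral, hence is finite almost
    everywhere. *)
Lemma negligible_weighted_sum_infty d (X : measurableType d) (R : realType)
    (P : {measure set X -> \bar R}) (w : nat -> R) (E : nat -> set X) :
  (forall n, 0 <= w n) -> (forall n, measurable (E n)) ->
  (\sum_(0 <= n <oo) (w n)%:E * P (E n) < +oo)%E ->
  P.-negligible [set x | (\sum_(0 <= n <oo) (w n * \1_(E n) x)%:E = +oo)%E].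
Proof.
move=> w0 mE fin.
pose f n x : \bar R := (w n * \1_(E n) x)%:E.
have f0 n x : (0 <= f n x)%E by rewrite lee_fin mulr_ge0// indicE ler0n.
have mind n : measurable_fun setT (fun x => (\1_(E n) x : R)%:E).
  by apply/measurable_EFinP; exact/measurable_indicP.
have mf n : measurable_fun setT (f n).
  by apply/measurable_EFinP; apply: measurable_funM => //; exact/measurable_indicP.
have intf : (\int[P]_(x in setT) (\sum_(0 <= n <oo) f n x) =
    \sum_(0 <= n <oo) (w n)%:E * P (E n))%E.
  rewrite integral_nneseries//; apply: eq_eseriesr => n _.
  under eq_integral do rewrite /f EFinM.
  rewrite ge0_integralZl_EFin//.
  by rewrite integral_indic// setIT.
have sum0 x : (0 <= \sum_(0 <= n <oo) f n x)%E by exact: nneseries_ge0.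
have msum : measurable_fun setT (fun x => \sum_(0 <= n <oo) f n x)%E.
  by apply: (@ge0_emeasurable_sum _ _ _ _ f xpredT) => // ? ? _ _.
have : P.-integrable setT (fun x => \sum_(0 <= n <oo) f n x)%E.
  apply/integrableP; split => //.
  by under eq_integral do rewrite gee0_abs//; rewrite intf.
move=> /(integrable_ae measurableT); apply: negligibleS => x /= xoo /(_ I).
by rewrite /f xoo.
Qed.

Section missed_finitely_often.
Context {R : realType}.
Context (k : nat -> nat)
  (k_gt0 : forall n, (0 < n)%N -> (0 < k n)%N)
  (k_nondecreasing : forall m n, (0 < m)%N -> (m <= n)%N -> (k m <= k n)%N).
Local Notation T := (@gauss_map R).
Local Notation P0 := (@nu R 0).
Local Notation missed := (@missed R k).

(** Time 0 is unconstrained: given the first digit, [T x] has a law of the family, to which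
    [nu_no_hit_bounds] applies. *)
Lemma nu0_no_hit1_le m n : (0 < m)%N ->
  (P0 (no_hit m 1 n.+1) <= ((1 - m%:R^-1) ^+ n)%:E)%E.
Proof.
move=> m0; rewrite (@no_hit_split R m 1 1 n.+1)// subSS subn0.
have -> : no_hit m 1 1 = [set: R] by rewrite -subTset => x _ j /=; lia.
have q0 : 0 <= (1 - m%:R^-1 : R) ^+ n.
  by rewrite exprn_ge0// subr_ge0 invf_le1 ?ltr0n// ler1n.
have s0 : (0 : R) <= (0 : R) <= 1 by apply/andP; split.
have h t : 0 <= t <= 1 ->
    (0%:E <= nu t (no_hit m 0 n) <= ((1 - m%:R^-1 : R) ^+ n)%:E)%E.
  by move=> t01; case/andP: (nu_no_hit_bounds n t01 m0) => _ ->; rewrite measure_ge0.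
have dT : digit_determined 1 [set: R].
  by apply: (@digit_determined_leq _ 0) => //; left.
have := nu_digit_determinedI s0 dT measurableT (@measurable_no_hit R m 0 n)
  (lexx 0) q0 h.
by rewrite probability_setT !mule1 => /andP[].
Qed.

(** Here [n - n %/ D <= m] because [m %/ D <= n %/ D], and avoiding the target of [k m] implies
    avoiding the smaller target of [k n]. *)
Lemma missed_subset D m n : (0 < m)%N -> (m <= n)%N -> (n <= m + m %/ D)%N ->
  missed m `<=` no_hit (k n) 1 (n - n %/ D).+1.
Proof.
move=> m0 mn nm x h j /= /andP[j1]; rewrite ltnS => jn.
have jm : (j <= m)%N.
  apply: (leq_trans jn); rewrite leq_subLR addnC; apply: (leq_trans nm).
  by rewrite leq_add2l leq_div2r.
have := h j; rewrite /= j1 ltnS jm => /(_ isT); apply: contra_not.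
rewrite /target/= !in_itv/= => /andP[-> /= h1]; apply: (le_trans h1).
by rewrite lef_pV2 ?posrE ?ltr0n ?ler_nat ?k_nondecreasing ?k_gt0// (leq_trans m0).
Qed.

(* If [x] is in [missed m] then it is in the event weighted by [n^-1] below for
   all [n] between [m] and [m + m %/ D], a block of total weight at least
   [1 / (2 D)]. *)
Lemma nu0_missed_infinitely_often D : (0 < D)%N ->
  (\sum_(0 <= n <oo) (n%:R^-1 * (1 - (k n)%:R^-1) ^+ (n - n %/ D))%:E
    < +oo :> \bar R)%E ->
  P0 (\bigcap_M \bigcup_(m in [set m | (M <= m)%N]) missed m) = 0%E.
Proof.
move=> D0 fin.
pose E n : set R := no_hit (k n) 1 (n - n %/ D).+1.
have mE n : measurable (E n) by exact: measurable_no_hit.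
pose w n : R := n%:R^-1.
have w0 n : 0 <= w n by rewrite invr_ge0.
have finE : (\sum_(0 <= n <oo) (w n)%:E * P0 (E n) < +oo)%E.
  apply: le_lt_trans fin; apply: lee_nneseries => [n _ _|n _].
    by rewrite mule_ge0// lee_fin.
  have [->|n0] := posnP n; first by rewrite /w invr0 !mul0r mul0e.
  rewrite EFinM; apply: lee_wpmul2l; first by rewrite lee_fin.
  by apply: nu0_no_hit1_le; exact: k_gt0.
set S := \bigcap_M _.
have mS : measurable S.
  apply: bigcapT_measurable => M; apply: bigcup_measurable => m _.
  exact: measurable_missed.
have [A [mA A0 ZA]] := negligible_weighted_sum_infty w0 mE finE.
apply/eqP; rewrite eq_le measure_ge0 andbT -A0.
apply: le_measure; rewrite ?inE//; apply: subset_trans ZA => x Sx /=.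
apply: contrapT => /eqP; rewrite -ltey => finx.
have f0 n : (0 <= (w n * \1_(E n) x)%:E)%E.
  by rewrite lee_fin mulr_ge0// indicE ler0n.
(* Where the sum is finite its tails tend to 0, which is incompatible with blocks of weight
   [1 / (2 D)] arbitrarily far out. *)
have := nneseries_tail_cvg finx (fun n _ => f0 n).
move=> /fine_cvgP[[N1 _ fin1] /cvgr0Pnorm_lt].
have c0 : 0 < (2 * D%:R)^-1 :> R by rewrite invr_gt0 mulr_gt0 ?ltr0n.
move=> /(_ _ c0)[N2 _ tail].
have [m /= Nm missedm] := Sx (maxn 1 (maxn N1 N2)) I.
have m0 : (0 < m)%N by lia.
have := tail m; have := fin1 m => /= /(_ _) h1 /(_ _) h2.
have /fineK mfin : (\sum_(m <= n <oo) (w n * \1_(E n) x)%:E)%E \is a fin_num.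
  by apply: h1 => /=; lia.
move: h2; rewrite ger0_norm ?fine_ge0 ?nneseries_ge0// => h2.
suff : (2 * D%:R)^-1 <= fine (\sum_(m <= n <oo) (w n * \1_(E n) x)%:E)%E.
  by rewrite leNgt h2 //; lia.
rewrite -lee_fin mfin.
apply: (@le_trans _ _ (\sum_(m <= n < m + (m %/ D).+1) (w n * \1_(E n) x)%:E)%E);
  last by apply: nneseries_lim_ge.
rewrite sumEFin lee_fin.
(* In the block [n <= 2 m], and its [m %/ D + 1] terms number more than [m / D]. *)
apply: (@le_trans _ _ (\sum_(m <= n < m + (m %/ D).+1) (2 * m%:R)^-1)).
  rewrite sumr_const_nat addKn -[leRHS]mulr_natl.
  have mD : m%:R <= D%:R * (m %/ D).+1%:R :> R.
    by rewrite -natrM ler_nat mulnC ltnW// ltn_ceil.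
  have mR : 0 < m%:R :> R by rewrite ltr0n.
  have DR : 0 < D%:R :> R by rewrite ltr0n.
  rewrite ler_pdivlMr ?mulr_gt0// mulrC ler_pdivrMr ?mulr_gt0//; lra.
rewrite big_nat_cond [leRHS]big_nat_cond; apply: ler_sum => n.
rewrite andbT => /andP[mn nm].
have En : E n x.
  by apply: (missed_subset m0 mn) missedm; rewrite -ltnS -addnS.
have nR : 0 < n%:R :> R by rewrite ltr0n (leq_trans m0).
have mR : 0 < m%:R :> R by rewrite ltr0n.
rewrite indicE mem_set// mulr1 /w lef_pV2 ?posrE ?mulr_gt0//.
rewrite -natrM ler_nat mul2n -addnn.
have := leq_div m D; lia.
Qed.
End missed_finitely_often.

(** * Comparison with the Gauss measure *)

Section exponent_comparison.
Context {R : realType}.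
Implicit Types (x u : R).

Lemma ln1D_ge x : 0 <= x -> x / (1 + x) <= ln (1 + x).
Proof.
move=> x0; have x1 : 0 < 1 + x by lra.
have e : 1 + - (x / (1 + x)) = (1 + x)^-1 by field; rewrite gt_eqF.
have : ln (1 + - (x / (1 + x))) <= - (x / (1 + x)).
  by apply: le_ln1Dx; rewrite ltrN2 ltr_pdivrMr//; lra.
by rewrite e lnV ?posrE// lerN2.
Qed.

Lemma ln1B_ge u : u < 1 -> - (u / (1 - u)) <= ln (1 - u).
Proof.
move=> u1; have u0 : 0 < 1 - u by lra.
have e : 1 + u / (1 - u) = (1 - u)^-1 by field; rewrite gt_eqF.
have : ln (1 + u / (1 - u)) <= u / (1 - u).
  by apply: le_ln1Dx; rewrite -subr_gt0 opprK addrC e invr_gt0.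
by rewrite e lnV ?posrE// lerNl.
Qed.

Lemma ln2_gt : 2^-1 <= ln 2 :> R.
Proof. by have := @ln1D_ge 1 ler01; rewrite mul1r. Qed.

(** The Gauss measure of [target k], for [k > 0]. *)
Definition gauss_mass (k : nat) : R := ln (1 + k%:R^-1) / ln 2.

Lemma gauss_mass_bounds (k : nat) : (0 < k)%N ->
  (k%:R + 1)^-1 <= ln 2 * gauss_mass k <= k%:R^-1.
Proof.
move=> k0; have k1 : 0 < k%:R :> R by rewrite ltr0n.
have l2 := ln2_gt; have kV : 0 < k%:R^-1 :> R by rewrite invr_gt0.
have l20 : ln 2 != 0 :> R by rewrite gt_eqF//; lra.
rewrite /gauss_mass mulrC divfK//.
rewrite le_ln1Dx ?andbT; last lra.
apply: le_trans (ln1D_ge (ltW kV)).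
by rewrite le_eqVlt; apply/orP; left; apply/eqP; field; rewrite !gt_eqF//; lra.
Qed.

Lemma gauss_mass_lt1 (k : nat) : (2 < k)%N ->
  0 <= gauss_mass k /\ gauss_mass k <= 2 * k%:R^-1 /\ gauss_mass k < 1.
Proof.
move=> k2; have k0 : (0 < k)%N by lia.
have k3 : 3 <= k%:R :> R by rewrite ler_nat.
have kV : 0 < k%:R^-1 :> R by rewrite invr_gt0 ltr0n.
have kV3 : k%:R^-1 <= 3^-1 :> R by rewrite lef_pV2 ?posrE ?ltr0n.
have l2 := ln2_gt.
have k1V : 0 < (k%:R + 1)^-1 :> R by rewrite invr_gt0; lra.
have /andP[h1 h2] := gauss_mass_bounds k0.
have g0 : 0 <= gauss_mass k by rewrite -(pmulr_rge0 _ (x := ln 2)); lra.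
have : 2^-1 * gauss_mass k <= ln 2 * gauss_mass k by exact: ler_wpM2r.
by move=> h; split => //; split; lra.
Qed.

(** After taking logarithms, the slack [c] is shared: one half pays for the [n %/ D] times given up,
    since [1 / D <= c / 2], the other for the factor [1 / (1 - g)] in the lower bound on
    [ln (1 - g)], since [g <= 2 / k <= c / 2]. *)
Lemma no_hit_le_gauss_mass (k n D : nat) (eps c : R) : (2 < k)%N ->
  0 < c -> c <= eps -> c <= 1 -> 4 / c <= k%:R -> (0 < D)%N -> 2 / c <= D%:R ->
  (1 - k%:R^-1) ^+ (n - n %/ D) <=
  (1 - gauss_mass k) `^ (ln 2 * (1 - eps) * n%:R).
Proof.
move=> k2 c0 ceps c1 kc D0 Dc; have k0 : (0 < k)%N by lia.
have kR : 3 <= k%:R :> R by rewrite ler_nat.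
have kV : 0 < k%:R^-1 :> R by rewrite invr_gt0; lra.
have [g0 [gk g1]] := gauss_mass_lt1 k2.
have /andP[_ gle] := gauss_mass_bounds k0.
have l2 := ln2_gt; have nR : 0 <= n%:R :> R by [].
rewrite /powR gt_eqF ?subr_gt0//.
set g := gauss_mass k in g0 gk g1 gle *.
have kc' : k%:R^-1 <= c / 4.
  by rewrite -[leRHS]invrK lef_pV2 ?posrE ?invr_gt0 ?divr_gt0// ?invf_div; lra.
have Dc' : D%:R^-1 <= c / 2.
  by rewrite -[leRHS]invrK lef_pV2 ?posrE ?invr_gt0 ?divr_gt0 ?ltr0n// ?invf_div; lra.
have hN : n%:R * (1 - c / 2) <= (n - n %/ D)%:R.
  rewrite natrB ?leq_div// mulrBr mulr1 lerB//.
  have : (n %/ D)%:R <= n%:R / D%:R :> R.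
    by rewrite ler_pdivlMr ?ltr0n// -natrM ler_nat leq_divM.
  by move=> /le_trans; apply; rewrite ler_wpM2l.
have base : 1 - k%:R^-1 <= expR (- k%:R^-1) :> R by exact: expR_ge1Dx.
apply: (@le_trans _ _ (expR (- k%:R^-1) ^+ (n - n %/ D))).
  apply: lerXn2r => //; rewrite nnegrE; lra.
rewrite -expRM_natl ler_expR.
apply: (@le_trans _ _ (n%:R * (1 - c / 2) * - k%:R^-1)).
  by rewrite !mulrN lerN2 ler_wpM2r// ltW.
have lng : ln (1 - g) <= 0 by have := @le_ln1Dx R (- g); lra.
apply: (@le_trans _ _ (n%:R * (ln 2 * (1 - c) * ln (1 - g)))); last first.
  rewrite -[_ * n%:R * _]mulrA [n%:R * ln _]mulrC [leRHS]mulrA [leRHS]mulrC.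
  rewrite ler_wpM2l//.
  by apply: ler_wnM2r => //; apply: ler_wpM2l; lra.
rewrite -mulrA ler_wpM2l//.
have := ln1B_ge g1 => lnge.
apply: (@le_trans _ _ (ln 2 * (1 - c) * - (g / (1 - g)))); last first.
  by apply: ler_wpM2l => //; apply: mulr_ge0; lra.
rewrite !mulrN lerN2.
have -> : ln 2 * (1 - c) * (g / (1 - g)) = (1 - c) / (1 - g) * (ln 2 * g).
  by field; rewrite gt_eqF//; lra.
apply: (@le_trans _ _ ((1 - c) / (1 - g) * k%:R^-1)).
  by apply: ler_wpM2l => //; apply: divr_ge0; lra.
apply: ler_wpM2r; first exact: ltW.
rewrite ler_pdivrMr; last lra.
have : (1 - c / 2) * (1 - c / 2) <= (1 - c / 2) * (1 - g).
  by apply: ler_wpM2l; lra.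
have := sqr_ge0 (c / 2); rewrite expr2; lra.
Qed.

(** The logarithms compare [2 (1 + eps) / (k + 1)] with [2 / (k - 1) + eps / k]. About half of the
    surplus [2 eps / (k + 1)] is kept as the exponential factor that [bounded_sum_of_decrements]
    requires; the rest absorbs the gap between [2 / (k - 1)] and [2 / (k + 1)]. *)
Lemma gauss_mass_le_no_hit (k n : nat) (eps : R) : (2 < k)%N ->
  0 < eps -> 16 / eps <= k%:R ->
  (1 - gauss_mass k) `^ (2 * ln 2 * (1 + eps) * n%:R) <=
  (1 - 2 / (k%:R + 1)) ^+ n * expR (- (eps * n%:R / k%:R)).
Proof.
move=> k2 eps0 keps; have k0 : (0 < k)%N by lia.
have kR : 3 <= k%:R :> R by rewrite ler_nat.
have [g0 [gk g1]] := gauss_mass_lt1 k2.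
have /andP[gge _] := gauss_mass_bounds k0.
rewrite /powR gt_eqF ?subr_gt0//.
set g := gauss_mass k in g0 gk g1 gge *; set K : R := k%:R in kR keps gk gge *.
have v1 : 2 / (K + 1) < 1 by rewrite ltr_pdivrMr; lra.
have -> : 1 - 2 / (K + 1) = expR (ln (1 - 2 / (K + 1))).
  by rewrite lnK// posrE; lra.
rewrite -expRM_natl -expRD ler_expR.
have -> : 2 * ln 2 * (1 + eps) * n%:R * ln (1 - g) =
    n%:R * (2 * (1 + eps) * (ln 2 * ln (1 - g))) by ring.
have -> : n%:R * ln (1 - 2 / (K + 1)) - eps * n%:R / K =
    n%:R * (ln (1 - 2 / (K + 1)) - eps / K) by ring.
rewrite ler_wpM2l//.
have lng : ln (1 - g) <= - g by have := @le_ln1Dx R (- g); apply; lra.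
have h1 : ln 2 * ln (1 - g) <= - (K + 1)^-1.
  apply: (@le_trans _ _ (ln 2 * - g)); last by rewrite mulrN lerN2.
  by apply: ler_wpM2l => //; have := ln2_gt; lra.
have h2 := ln1B_ge v1.
apply: (@le_trans _ _ (2 * (1 + eps) * - (K + 1)^-1)).
  by apply: ler_wpM2l => //; lra.
apply: (@le_trans _ _ (- (2 / (K + 1) / (1 - 2 / (K + 1))) - eps / K)); last lra.
rewrite -subr_ge0.
have -> : - (2 / (K + 1) / (1 - 2 / (K + 1))) - eps / K
      - 2 * (1 + eps) * - (K + 1)^-1 =
    (eps * (K - 1) ^+ 2 - 4 * K) / (K * (K - 1) * (K + 1)).
  by field; rewrite !gt_eqF//; lra.
apply: divr_ge0; last by apply: mulr_ge0; [apply: mulr_ge0|]; lra.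
have e16 : 16 <= eps * K by move: keps; rewrite ler_pdivrMr// mulrC.
(* It remains to see that [4 K <= eps (K - 1) ^ 2], which follows from [K / 2 <= K - 1] and
   [16 <= eps K]. *)
have : (K / 2) ^+ 2 <= (K - 1) ^+ 2 by apply: lerXn2r; rewrite ?nnegrE; lra.
move=> /(ler_wpM2l (ltW eps0)); have : 16 * K <= eps * K * K by apply: ler_wpM2r; lra.
have -> : eps * (K / 2) ^+ 2 = eps * K * K / 4 by field.
lra.
Qed.

End exponent_comparison.

(** * Transfer to the Gauss measure and conclusion *)

Lemma nneseries_ltey_tail (R : realType) (f g : nat -> \bar R) (N : nat) :
  (forall n, 0 <= f n)%E -> (forall n, 0 <= g n)%E ->
  (forall n, (n < N)%N -> f n \is a fin_num) ->
  (forall n, (N <= n)%N -> (f n <= g n)%E) ->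
  (\sum_(0 <= n <oo) g n < +oo)%E -> (\sum_(0 <= n <oo) f n < +oo)%E.
Proof.
move=> f0 g0 ffin fg; 
rewrite (@nneseries_split _ g 0 N)// (@nneseries_split _ f 0 N)// !add0n => goo.
apply: lte_add_pinfty.
  rewrite big_nat_cond; apply: lte_sum_pinfty => n /andP[nN _].
  by rewrite ltey_eq ffin.
rewrite eseries_cond.
apply: (@le_lt_trans _ _ (\sum_(N <= n <oo) g n)%E).
  rewrite [leRHS]eseries_cond; exact: lee_nneseries.
apply: le_lt_trans goo; rewrite leeDr//.
by apply: sume_ge0 => n _.
Qed.

Section gauss_null.
Context {R : realType}.
Local Notation T := (@gauss_map R).

(** [nu 0] is Lebesgue measure on ]0, 1[, with respect to which the Gauss measure has a density; the
    endpoints 0 and 1 are null. *)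
Lemma gauss_measure_null (A : set R) : measurable A -> nu 0 A = 0%E ->
  gauss_measure A = 0%E.
Proof.
move=> mA; rewrite nuE.
have -> : quantile 0 @^-1` A = A.
  by apply/seteqP; split=> u; rewrite /preimage/= /quantile addr0 mul0r subr0 divr1.
move=> A0; rewrite /gauss_measure.
have mAI (i : interval R) : measurable (A `&` [set` i]).
  by apply: measurableI => //; exact: measurable_itv.
rewrite null_set_integral ?mule0//; last first.
  have m01 : measurable ([set 0; 1] : set R).
    by apply: measurableU; exact: measurable_set1.
  have l01 : lebesgue_measure ([set 0; 1] : set R) = 0%E.
    by apply: countable_lebesgue_measure0; exact: finite_set_countable.
  apply/eqP; rewrite eq_le measure_ge0 andbT -A0.
  have <- : lebesgue_measure (A `&` `]0, 1[ `|` [set 0; 1]) =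
      lebesgue_measure (A `&` `]0, 1[).
    by rewrite measureU0//; exact: mAI.
  apply: le_measure; rewrite ?inE//.
  - exact: mAI.
  - by apply: measurableU => //; exact: mAI.
  move=> x [Ax]; rewrite /= in_itv/= => /andP[].
  rewrite le_eqVlt => /predU1P[<- _|x0]; first by right; left.
  rewrite le_eqVlt => /predU1P[->|x1]; first by right; right.
  by left; split => //; rewrite /= in_itv/= x0.
  apply/measurable_EFinP; apply: measurable_funTS.
  apply: (measurableT_comp (@measurable_invr R)); exact: measurable_funD.
exact: mAI.
Qed.

Lemma eventually_always_hittingE (k : nat -> nat) :
  eventually_always_hitting `[0, 1]%classic T
    (fun m => `[0, (k m)%:R^-1]%classic) =
  `[0, 1]%classic `&`
  \bigcup_M \bigcap_(m in [set m | (M <= m)%N]) ~` missed k m.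
Proof.
have hitE m x : (orbit_segment T x m `&` `[0, (k m)%:R^-1] !=set0) <->
    (~` missed k m) x.
  split=> [[_ [[j /= jm <-] Tj]] h|].
    by apply: (h j) => //=; rewrite ltnS.
  move=> /existsNP[j /not_implyP[/= jm /contrapT Tj]].
  by exists (iter j T x); split=> //; exists j => //=; move: jm; rewrite ltnS.
rewrite /eventually_always_hitting; apply/seteqP; split => x /= [x01].
  by case=> M _ h; split=> //; exists M => // m /h /hitE.
by case=> M _ h; split=> //; exists M => // m /h /hitE.
Qed.

End gauss_null.

(** The term at 0 vanishes, as [0^-1 = 0]. *)
Lemma nneseries_div_nat (R : realType) (u : nat -> R) : (forall n, 0 <= u n) ->
  (\sum_(0 <= n <oo) (u n / n%:R)%:E = \sum_(1 <= n <oo) (u n / n%:R)%:E)%E.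
Proof.
move=> u0; rewrite (@nneseries_split _ _ 0 1)//; last first.
  by move=> n _; rewrite lee_fin divr_ge0.
by rewrite add0n big_nat1 invr0 mulr0 add0e.
Qed.

Theorem theorem1p6 (R : realType) (k : nat -> nat)
    (k_gt0 : forall m, (1 <= m)%N -> (1 <= k m)%N)
    (k_nondecreasing : forall m n, (1 <= m)%N -> (m <= n)%N -> (k m <= k n)%N)
    (k_infty : k @ \oo --> \oo)
    (k_growth :
      (exists2 sigma : R, sigma < 1 &
         \forall m \near \oo, (k m)%:R <= sigma * m%:R / ln (ln m%:R)) \/
      (exists2 tau : R, 0 < tau &
         \forall m \near \oo, (ln m%:R) `^ tau <= (k m)%:R)) :
  let X : set R := `[0, 1]%classic in
  let mu : probability R R := gauss_measure in
  let B (m : nat) : set R := `[0, (k m)%:R^-1]%classic in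
  let H : set R := eventually_always_hitting X gauss_map B in
  ((exists2 eps : R, 0 < eps &
      (\sum_(1 <= n <oo)
         ((1 - fine (mu (B n))) `^ (ln 2 * (1 - eps) * n%:R) / n%:R)%:E
       < +oo)%E) ->
    mu H = 1%E) /\
  ((exists2 eps : R, 0 < eps &
      (\sum_(1 <= n <oo)
         ((1 - fine (mu (B n))) `^ (2 * ln 2 * (1 + eps) * n%:R) / n%:R)%:E
       = +oo)%E) ->
    mu H = 0%E).
Proof.
move=> X mu B H.
have k_large (x : R) : exists2 N, (0 < N)%N & forall n, (N <= n)%N ->
    (2 < k n)%N /\ x <= (k n)%:R.
  have /cvgnyPge/(_ (maxn 3 (Num.truncn x).+1)) [N _ hN] := k_infty.
  exists N.+1 => // n Nn; have := hN n (ltnW Nn); rewrite geq_max => /andP[-> kx].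
  by split => //; apply/ltW/(lt_le_trans (truncnS_gt x)); rewrite ler_nat.
have muB n : (0 < n)%N -> fine (mu (B n)) = gauss_mass (k n).
  move=> n0; rewrite /mu /B/= gauss_measure_itv0c//.
  by rewrite invr_gt0 ltr0n k_gt0//= invf_le1 ?ltr0n ?ler1n k_gt0.
have HE : H = X `&` \bigcup_M \bigcap_(m in [set m | (M <= m)%N]) ~` missed k m.
  exact: eventually_always_hittingE.
have mX : measurable X by exact: measurable_itv.
have mH : measurable H.
  rewrite HE; apply: measurableI => //; apply: bigcup_measurable => M _.
  apply: bigcap_measurableType => m _; apply: measurableC.
  exact: measurable_missed.
have mu0 (A S : set R) : measurable A -> measurable S -> nu 0 S = 0%E ->
    A `&` X `<=` S -> mu A = 0%E.
  move=> mA mS S0 AS.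
  have -> : mu A = mu (A `&` X).
    by rewrite /mu/= /gauss_measure -setIA setIid.
  apply/eqP; rewrite eq_le measure_ge0 andbT -(gauss_measure_null mS S0).
  by apply: le_measure; rewrite ?inE//; exact: measurableI.
split=> -[eps eps0].
  set g := (fun n => _); rewrite -nneseries_div_nat; last first.
    by move=> n; exact: powR_ge0.
  move=> fin.
  (* [eps] may exceed 1; the minimum keeps [1 - c] nonnegative. *)
  pose c := Num.min eps 1.
  have c0 : 0 < c by rewrite lt_min eps0 ltr01.
  have ceps : c <= eps by rewrite ge_min lexx.
  have c1 : c <= 1 by rewrite ge_min lexx orbT.
  pose D := (Num.truncn (2 / c)).+1.
  have Dc : 2 / c <= D%:R by exact/ltW/truncnS_gt.
  have [N N0 hN] := k_large (4 / c).
  pose S : set R := \bigcap_M \bigcup_(m in [set m | (M <= m)%N]) missed k m.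
  have mS : measurable S.
    apply: bigcapT_measurable => M; apply: bigcup_measurable => m _.
    exact: measurable_missed.
  have S0 : nu 0 S = 0%E.
    apply: (@nu0_missed_infinitely_often R k k_gt0 k_nondecreasing D) => //.
    apply: nneseries_ltey_tail fin.
    - move=> n; rewrite lee_fin; have [->|n0] := posnP n.
        by rewrite invr0 mul0r.
      rewrite mulr_ge0 ?invr_ge0// exprn_ge0// subr_ge0 invf_le1 ?ltr0n ?k_gt0//.
      by rewrite ler1n k_gt0.
    - by move=> n; rewrite lee_fin divr_ge0// powR_ge0.
    - by [].
    - move=> n Nn; have [k2 kc] := hN n Nn.
      rewrite muB ?(leq_trans N0)// lee_fin mulrC ler_wpM2r ?invr_ge0//.
      exact: (@no_hit_le_gauss_mass R (k n) n D eps c).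
  (* Within [X], a point outside [H] misses its target for infinitely many [m]. *)
  have HC0 : mu (~` H) = 0%E.
    apply: (mu0 _ S) => //; first exact: measurableC.
    move=> x [nHx Xx]; apply: contrapT => nSx; apply: nHx.
    rewrite HE; split=> //; move/existsNP : nSx => [M /not_implyP[_ nM]].
    by exists M => // m Mm lx; apply: nM; exists m.
  by rewrite -[H]setCK probability_setC ?HC0 ?sube0//; exact: measurableC.
rewrite -nneseries_div_nat; last by move=> n; exact: powR_ge0.
move=> infin.
pose t n := (1 - fine (mu (B n))) `^ (2 * ln 2 * (1 + eps) * n%:R).
have [J0 J00 hJ] := k_large (16 / eps).
have tdiv J : forall C, exists N, C < \sum_(J <= n < N) t n / n%:R.
  move=> C; apply: contrapT => /forallNP hC.
  have t0 n : (0 <= (t n / n%:R)%:E)%E by rewrite lee_fin divr_ge0// powR_ge0.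
  have : (\sum_(0 <= n <oo) (t n / n%:R)%:E < +oo)%E.
    rewrite (nneseries_split 0 J)// add0n; apply: lte_add_pinfty.
      by rewrite sumEFin ltry.
    apply: (@le_lt_trans _ _ C%:E); last exact: ltry.
    apply: lime_le; first exact: is_cvg_nneseries.
    apply: nearW => N; rewrite sumEFin lee_fin leNgt.
    exact/negP/hC.
  by rewrite infin ltxx.
(* A point of [H] has no miss from some index on, so [H] lies in the union of the [F J]; the shift
   by [J0] keeps [k n] large enough for [gauss_mass_le_no_hit]. *)
pose F J := \bigcap_i @never_missed R k (J0 + J) i.
have mF J : measurable (F J).
  by apply: bigcapT_measurable => i; exact: measurable_never_missed.
have F0 J : nu 0 (F J) = 0%E.
  apply: (@nu0_never_missed R k k_gt0 t eps) => //; first by rewrite addn_gt0 J00.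
  move=> n Jn; have J0n : (J0 <= n)%N by apply: leq_trans Jn; rewrite leq_addr.
  have [k2 kc] := hJ n J0n.
  rewrite powR_ge0 /t muB ?(leq_trans J00)//.
  exact: gauss_mass_le_no_hit.
have mUF : measurable (\bigcup_J F J) by exact: bigcup_measurable.
apply: (mu0 _ (\bigcup_J F J)) => //.
  apply/negligibleP => //; apply: negligible_bigcup => J.
  by apply/negligibleP => //; exact: F0.
move=> x [+ _]; rewrite HE => -[_ [M _ hM]].
exists M => // i _ n /= /andP[Mn _]; apply: hM.
by rewrite /= (leq_trans _ Mn)// leq_addl.
Qed.
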